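(* Let $t_k>0$ and $t_{k+1}>0$, let $x_{t_k}\in\mathrm{dom}(F)$, let $\delta_k\ge 0$, and let $x_{t_{k+1}}\in\mathrm{dom}(F)$ be a $\delta_k$-solution of the proximal-Newton subproblem at $x_{t_k}$ with parameter $t_{k+1}$. Put $$\lambda_{t_k}^+:=\|x_{t_k}-x^*_{t_k}\|_{x^*_{t_k}},\quad \lambda_{t_{k+1}}:=\|x_{t_k}-x^*_{t_{k+1}}\|_{x^*_{t_{k+1}}},\quad \lambda_{t_{k+1}}^+:=\|x_{t_{k+1}}-x^*_{t_{k+1}}\|_{x^*_{t_{k+1}}},\quad \Delta_k:=\|x^*_{t_{k+1}}-x^*_{t_k}\|_{x^*_{t_{k+1}}}.$$ Let $\beta\in(0,0.15]$ be fixed, and assume that $$\delta_k\le 0.075\,\beta\qquad\text{and}\qquad \Delta_k\le\frac{\sqrt{\beta}-2.581\,\beta}{2.581+\sqrt{\beta}}.$$ If $\lambda_{t_k}^+\le\beta$, then $\lambda_{t_{k+1}}\le\frac{1}{2.581}\sqrt{\beta}$ and $\lambda_{t_{k+1}}^+\le\beta$.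
   Context: Self-concordance: a convex function $\varphi$ of one real variable is standard self-concordant if $|\varphi'''(\tau)|\le 2\varphi''(\tau)^{3/2}$ on its domain. A function $f:\mathrm{dom}(f)\subseteq\mathbb{R}^n\to\mathbb{R}$ is (standard) self-concordant if for all $x\in\mathrm{dom}(f)$ and $v\in\mathbb{R}^n$ the function $\tau\mapsto f(x+\tau v)$ is standard self-concordant on $\{\tau: x+\tau v\in\mathrm{dom}(f)\}$. As usual, $\mathrm{dom}(f)$ is open and convex, $f$ is convex and $C^3$ on it, and $f$ is closed (lower semicontinuous when extended by $+\infty$). It is a $\nu$-self-concordant barrier ($\nu>0$) for $\mathrm{Dom}(f):=\mathrm{cl}(\mathrm{dom}(f))$ if moreover $\sup_{u\in\mathbb{R}^n}\{2\nabla f(x)^Tu-\|u\|_x^2\}\le\nu$ for all $x\in\mathrm{dom}(f)$. Standing assumptions: $f$ is a $\nu$-self-concordant barrier for $\mathrm{Dom}(f)$ with $\nabla^2f(x)\succ0$ on $\mathrm{dom}(f)$; $g:\mathbb{R}^n\to\mathbb{R}\cup\{+\infty\}$ is proper, lower semicontinuous and convex. Local norm: $\|u\|_x:=[u^T\nabla^2f(x)u]^{1/2}$. For $t>0$, $F(x;t):=f(x)+t^{-1}g(x)$ and $\mathrm{dom}(F):=\mathrm{dom}(f)\cap\mathrm{dom}(g)$. For each value of $t$ considered, $F(\cdot;t)$ is assumed to have a (necessarily unique) minimizer $x^*_t\in\mathrm{dom}(F)$. Proximal-Newton subproblem at $y\in\mathrm{dom}(F)$ with parameter $t$: minimize over $x\in\mathrm{dom}(F)$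 the function $$\widehat F(x;t,y):=f(y)+\nabla f(y)^T(x-y)+\tfrac12(x-y)^T\nabla^2f(y)(x-y)+t^{-1}g(x).$$ It is assumed to have its (unique) exact solution $\bar x\in\mathrm{dom}(F)$. A point $x^+\in\mathrm{dom}(F)$ is a $\delta$-solution ($\delta\ge0$) if $\widehat F(x^+;t,y)-\widehat F(\bar x;t,y)\le\delta^2/2$. *)

(* Defs.v *)
From HB Require Import structures.
From mathcomp Require Import all_boot all_order all_algebra.
From mathcomp Require Import all_classical all_reals all_analysis.

Set Implicit Arguments.
Unset Strict Implicit.
Unset Printing Implicit Defensive.

Import Order.TTheory GRing.Theory Num.Theory.
Import numFieldNormedType.Exports.

Local Open Scope classical_set_scope.
Local Open Scope ring_scope.

(* Vectors of R^n are row vectors, so a^T b is written a *m b^T.  A function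
   f : dom(f) -> R is a total function together with the set D = dom(f); every
   notion below depends only on its values on D, which is assumed open. *)

Section calculus.
Context {R : realType} {n : nat}.
Implicit Types (f : 'rV[R]_n -> R) (D : set 'rV[R]_n).

Definition dotv (a b : 'rV[R]_n) : R := (a *m b^T) 0 0.

Definition grad f (x : 'rV[R]_n) : 'rV[R]_n :=
  \row_i 'D_(delta_mx 0 i) f x.

Definition hess f (x : 'rV[R]_n) : 'M[R]_n :=
  \matrix_(i, j) 'D_(delta_mx 0 i) ('D_(delta_mx 0 j) f) x.

Definition quad (A : 'M[R]_n) (u : 'rV[R]_n) : R := (u *m A *m u^T) 0 0.

Definition posdef (A : 'M[R]_n) : Prop := forall u, u != 0 -> 0 < quad A u.

Definition local_norm f (x u : 'rV[R]_n) : R := Num.sqrt (quad (hess f x) u).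

(* C^(k+1): differentiable, with a differential whose coordinates are C^k. *)
Fixpoint Ck (k : nat) D f : Prop :=
  match k with
  | 0 => forall x, D x -> {for x, continuous f}
  | k'.+1 => (forall x, D x -> differentiable f x) /\
             (forall v, Ck k' D ('D_v f))
  end.

Definition extend_oo D f (x : 'rV[R]_n) : \bar R :=
  if x \in D then (f x)%:E else +oo%E.

End calculus.

Section self_concordance.
Context {R : realType} {n : nat}.

Record std_self_concordant1 (I : set R) (phi : R -> R) : Prop := {
  sc1_convex : convex_function (I : set (convex_lmodType R^o)) phi ;
  sc1_derivable : forall (k : nat) tau,
    (k < 3)%N -> I tau -> derivable (derive1n k phi) tau 1 ;
  sc1_bound : forall tau, I tau ->
    `|derive1n 3 phi tau| <= 2 * (derive1n 2 phi tau) `^ (3 / 2) }.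

Record self_concordant (D : set 'rV[R]_n) (f : 'rV[R]_n -> R) : Prop := {
  sc_open : open D ;
  sc_convex_dom : convex_set (D : set (convex_lmodType 'rV[R]_n)) ;
  sc_convex : convex_function (D : set (convex_lmodType 'rV[R]_n)) f ;
  sc_C3 : Ck 3 D f ;
  sc_closed : lower_semicontinuous (extend_oo D f) ;
  sc_lines : forall x v, D x ->
    std_self_concordant1 [set tau : R | D (x + tau *: v)]
                         (fun tau : R => f (x + tau *: v)) }.

Record sc_barrier (nu : R) (D : set 'rV[R]_n) (f : 'rV[R]_n -> R) : Prop := {
  scb_nu : 0 < nu ;
  scb_sc : self_concordant D f ;
  scb_sup : forall x, D x ->
    (ereal_sup [set (2 * dotv (grad f x) u - (local_norm f x u) ^+ 2)%:E
               | u in [set: 'rV[R]_n]] <= nu%:E)%E }.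

End self_concordance.

Section composite.
Context {R : realType} {n : nat}.
Implicit Types (f : 'rV[R]_n -> R) (g : 'rV[R]_n -> \bar R).
Implicit Types (D : set 'rV[R]_n) (x y : 'rV[R]_n) (t delta : R).
Local Open Scope ereal_scope.

Definition edom g : set 'rV[R]_n := [set x | g x < +oo].

Definition eproper g : Prop :=
  (forall x, -oo < g x) /\ (exists x, edom g x).

Definition econvex g : Prop := forall x y t, (0 <= t <= 1)%R ->
  g (t *: x + (1 - t) *: y)%R <= t%:E * g x + (1 - t)%:E * g y.

Definition domF D g : set 'rV[R]_n := D `&` edom g.

Definition F f g t x : \bar R := (f x)%:E + (t^-1)%:E * g x.

Definition Fhat f g t y x : \bar R :=
  (f y + dotv (grad f y) (x - y) + 2^-1 * quad (hess f y) (x - y))%:E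
  + (t^-1)%:E * g x.

Definition minimizer (A : set 'rV[R]_n) (h : 'rV[R]_n -> \bar R) x : Prop :=
  A x /\ forall z, A z -> h x <= h z.

(* xbar is meant to be the exact solution of the subproblem at y. *)
Definition delta_solution D f g t y xbar delta x : Prop :=
  domF D g x /\ Fhat f g t y x - Fhat f g t y xbar <= (delta ^+ 2 / 2)%:E.

End composite.

(* Main.v *)
(* The Hessian of [f] along a segment satisfies a differential inequality: since
   [|D^3 f(x)[h, v, v]| <= 2 |h|_x |v|_x^2], which follows from the same bound
   on the diagonal by Banach's theorem on symmetric trilinear forms, one gets
   [(1 - r) |v|_z <= |v|_y <= |v|_z / (1 - r)] with [r = |z - y|_y < 1].  This
   gives [lambda <= beta / (1 - Delta) + Delta], and the assumption on [Delta] is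
   tuned so that the right-hand side is at most [sqrt beta / c], [c = 2.581], by
   [(c + s)^2 <= (1 + c^2) (1 + s^2)].
   For the second claim let [y] be the new minimizer, [x] the current point,
   [xbar] the exact Newton step and [d = xbar - y].  Adding the optimality
   inequalities of [y] and [xbar] eliminates [g] and bounds [|d|_x^2] by
   [(f'(y) - f'(x) - f''(x)(y - x)) d], at most
   [lambda^2 |d|_y / (1 - lambda)^3] by Taylor's formula.  Hence
   [|d|_y <= lambda^2 / (1 - lambda)^5]; inexactness adds at most
   [delta / (1 - lambda)]. *)

Require Import Defs.
From HB Require Import structures.
From mathcomp Require Import all_boot all_order all_algebra.
From mathcomp Require Import all_classical all_reals all_analysis.
From mathcomp Require Import ring lra.

Set Implicit Arguments.
Unset Strict Implicit.
Unset Printing Implicit Defensive.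

Import Order.TTheory GRing.Theory Num.Theory.
Import numFieldNormedType.Exports.

Local Open Scope classical_set_scope.
Local Open Scope ring_scope.

(** * Mean values and symmetry of second derivatives *)

Lemma mean_value (R : realType) (p dp : R -> R) (a b : R) : a <= b ->
  (forall t, a <= t <= b -> is_derive t 1 p (dp t)) ->
  exists2 c, a <= c <= b & p b - p a = dp c * (b - a).
Proof.
move=> ab dpP; have [||c cab ->] := @MVT_segment R p dp a b ab.
- by move=> t; rewrite in_itv /= => /andP[at_ tb]; apply: dpP; rewrite !ltW.
- apply: derivable_within_continuous => t; rewrite in_itv /= => tab.
  by have [] := dpP t tab.
by exists c; rewrite // -in_itv.
Qed.

Lemma ge0_derive_le (R : realType) (p dp : R -> R) (a b : R) : a <= b ->
  (forall t, a <= t <= b -> is_derive t 1 p (dp t)) ->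
  (forall t, a <= t <= b -> 0 <= dp t) -> p a <= p b.
Proof.
move=> ab dpP dp0; have [c cab e] := mean_value ab dpP.
by rewrite -subr_ge0 e mulr_ge0 ?subr_ge0// dp0.
Qed.

Lemma is_derive_line (R : realType) (n : nat) (f : 'rV[R]_n -> R)
    (x v : 'rV[R]_n) (t : R) : differentiable f (x + t *: v) ->
  is_derive t 1 (fun t => f (x + t *: v)) ('D_v f (x + t *: v)).
Proof.
move=> /(@diff_derivable _ _ _ _ _ v) df.
have e : (fun h : R => h^-1 *: (((fun t => f (x + t *: v)) \o shift t) (h *: 1)
      - f (x + t *: v)))
    = (fun h : R => h^-1 *: ((f \o shift (x + t *: v)) (h *: v)
      - f (x + t *: v))).
  apply/funext => h /=; congr (_ *: (f _ - _)).
  by rewrite [h *: 1]mulr1 scalerDl addrCA.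
by split; rewrite /derivable /derive e.
Qed.

(** The mean value theorem is applied twice: first in [a] to the increment of [f] over [s *: v],
    then in [b] to ['D_u f]. The second difference on the right is symmetric in [u] and [v]. *)
Lemma second_difference (R : realType) (n : nat) (f : 'rV[R]_n -> R)
    (x u v : 'rV[R]_n) (s : R) : 0 < s ->
  (forall a b, 0 <= a <= s -> 0 <= b <= s ->
     differentiable f (x + a *: u + b *: v) /\
     differentiable ('D_u f) (x + a *: u + b *: v)) ->
  exists a b, [/\ 0 <= a <= s, 0 <= b <= s &
    'D_v ('D_u f) (x + a *: u + b *: v) =
    (f (x + s *: u + s *: v) - f (x + s *: u) - f (x + s *: v) + f x)
      / s ^+ 2].
Proof.
move=> s_gt0 df; have s0 := ltW s_gt0.
have z0 : (0 : R) <= 0 <= s by rewrite s0 andbT.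
have zs : 0 <= s <= s by rewrite s0 lexx.
pose p a := f (x + s *: v + a *: u) - f (x + a *: u).
have [|a a0 pa] := @mean_value R p
  (fun a => 'D_u f (x + s *: v + a *: u) - 'D_u f (x + a *: u)) 0 s s0.
  move=> a a0; apply: is_deriveB; apply: is_derive_line.
    by rewrite addrAC; have [] := df a s a0 zs.
  by have [+ _] := df a 0 a0 z0; rewrite scale0r addr0.
have [|b b0 pb] := @mean_value R (fun b => 'D_u f (x + a *: u + b *: v))
  (fun b => 'D_v ('D_u f) (x + a *: u + b *: v)) 0 s s0.
  by move=> b b0; apply: is_derive_line; apply: (df a b a0 b0).2.
exists a, b; split=> //; move: pa pb; rewrite /p !scale0r !addr0 !subr0.
rewrite (addrAC x (s *: v)) (addrAC x (s *: v)) => pa pb.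
have -> : f (x + s *: u + s *: v) - f (x + s *: u) - f (x + s *: v) + f x =
    'D_v ('D_u f) (x + a *: u + b *: v) * s ^+ 2.
  by rewrite expr2 mulrA -pb -pa; ring.
by rewrite mulfK// expf_neq0// gt_eqF.
Qed.

Lemma dist_le_half (R : realType) (A B B' C e : R) :
  B = B' -> `|A - B| < e / 2 -> `|C - B'| < e / 2 -> `|A - C| <= e.
Proof.
by move=> -> AB CB; have := ler_distD B' A C; rewrite (distrC B'); lra.
Qed.

(** Schwarz's theorem. The same second difference quotient is a value of each mixed derivative at
    some point of a small box at [x]; continuity of both at [x] makes their values there differ by
    at most any [e > 0]. *)
Lemma derive_sym (R : realType) (n : nat) (D : set 'rV[R]_n)
    (f : 'rV[R]_n -> R) (x u v : 'rV[R]_n) :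
  open D -> Ck 2 D f -> D x -> 'D_v ('D_u f) x = 'D_u ('D_v f) x.
Proof.
move=> oD [df /all_and2[ddf cf]] Dx.
have c1 : {for x, continuous ('D_v ('D_u f))} by apply: (cf u v).
have c2 : {for x, continuous ('D_u ('D_v f))} by apply: (cf v u).
apply/eqP; rewrite -subr_eq0 -normr_le0; apply/ler_addgt0Pl => e e0.
rewrite addr0.
have [d d0 dP] : exists2 d, 0 < d & forall y, `|x - y| < d -> [/\ D y,
   `|'D_v ('D_u f) x - 'D_v ('D_u f) y| < e / 2 &
   `|'D_u ('D_v f) x - 'D_u ('D_v f) y| < e / 2].
  have e20 : 0 < e / 2 by lra.
  have cN (h : 'rV[R]_n -> R) : {for x, continuous h} ->
      \forall y \near x, `|h x - h y| < e / 2.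
    by move=> /cvgrPdist_lt; apply.
  have n1 : \forall y \near x, D y by exact: open_nbhs_nbhs.
  have FF : Filter (nbhs x) := nbhs_filter x.
  have /nbhs_ballP[d /= d0 dP] :=
    @filterI _ _ FF _ _ n1 (@filterI _ _ FF _ _ (cN _ c1) (cN _ c2)).
  exists d => // y xy; have {}xy : ball x d y by rewrite -ball_normE.
  by have [h1 [h2 h3]] := dP y xy; exact: And3 h1 h2 h3.
(* This side length keeps the box of [second_difference] inside the ball of radius [d]; the summand
   1 covers [u = v = 0]. *)
pose s := d / 2 / (`|u| + `|v| + 1).
have uv0 : 0 < `|u| + `|v| + 1 by rewrite ltr_wpDl ?addr_ge0.
have s0 : 0 < s by rewrite !divr_gt0.
have box a b : 0 <= a <= s -> 0 <= b <= s ->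
    `|x - (x + a *: u + b *: v)| < d.
  move=> /andP[a0 a1] /andP[b0 b1]; rewrite -addrA opprD addNKr normrN.
  apply: (le_lt_trans (ler_normD _ _)); rewrite !normrZ !ger0_norm//.
  have : s * (`|u| + `|v| + 1) = d / 2 by rewrite divfK// gt_eqF.
  have := ler_wpM2r (normr_ge0 u) a1; have := ler_wpM2r (normr_ge0 v) b1.
  lra.
have [|a [b [a0 b0 e1]]] := @second_difference R n f x u v s s0.
  by move=> a b a0 b0; have [Dy _ _] := dP _ (box a b a0 b0);
    split; [exact: df | exact: ddf].
have [|b' [a' [b'0 a'0 e2]]] := @second_difference R n f x v u s s0.
  move=> b' a' b0' a0'; rewrite addrAC.
  by have [Dy _ _] := dP _ (box a' b' a0' b0');
    split; [exact: df | exact: ddf].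
have e3 : 'D_v ('D_u f) (x + a *: u + b *: v)
   = 'D_u ('D_v f) (x + a' *: u + b' *: v).
  apply: (etrans e1); rewrite (addrAC x (a' *: u)) e2.
  by rewrite (addrAC x (s *: v)); congr (_ / _); ring.
have [_ h1 _] := dP _ (box a b a0 b0).
have [_ _ h2] := dP _ (box a' b' a'0 b'0).
exact: dist_le_half e3 h1 h2.
Qed.

(** * Second and third directional derivatives *)

Lemma derive_linear (R : realType) (n : nat) (f : 'rV[R]_n -> R)
    (x u v : 'rV[R]_n) (a : R) : differentiable f x ->
  'D_(a *: u + v) f x = a * 'D_u f x + 'D_v f x.
Proof. by move=> df; rewrite !deriveE// linearP. Qed.

Lemma derive_row (R : realType) (n : nat) (f : 'rV[R]_n -> R)
    (x v : 'rV[R]_n) : differentiable f x ->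
  'D_v f x = \sum_i v 0 i * 'D_(delta_mx 0 i) f x.
Proof.
move=> df; rewrite deriveE// [in LHS](row_sum_delta v) linear_sum.
by apply: eq_bigr => i _; rewrite linearZ/= deriveE.
Qed.

Definition D2 (R : realType) (n : nat) (f : 'rV[R]_n -> R)
  (x u v : 'rV[R]_n) : R := 'D_u ('D_v f) x.

Definition D3 (R : realType) (n : nat) (f : 'rV[R]_n -> R)
  (x u v w : 'rV[R]_n) : R := 'D_u ('D_v ('D_w f)) x.

Section higher_derivatives.
Context {R : realType} {n : nat} {D : set 'rV[R]_n} {f : 'rV[R]_n -> R}.
Hypotheses (oD : open D) (f_C3 : Ck 3 D f).
Implicit Types x u v w h : 'rV[R]_n.

Let df x : D x -> differentiable f x.
Proof. by case: f_C3 => + _; exact. Qed.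

Let df1 x v : D x -> differentiable ('D_v f) x.
Proof. by case: f_C3 => _ /(_ v)[+ _]; exact. Qed.

Let df2 x v w : D x -> differentiable ('D_w ('D_v f)) x.
Proof. by case: f_C3 => _ /(_ v)[_ /(_ w)[+ _]]; exact. Qed.

Let C2 v : Ck 2 D ('D_v f).
Proof. by case: f_C3 => _; exact. Qed.

Let C2f : Ck 2 D f.
Proof.
split=> // v; split=> [x|w x Dx]; first exact: df1.
by apply: differentiable_continuous; exact: df2.
Qed.

Lemma D2_sym x u v : D x -> D2 f x u v = D2 f x v u.
Proof. by move=> Dx; exact: derive_sym oD C2f Dx. Qed.

Lemma D2_linear x u v w a : D x ->
  D2 f x (a *: u + v) w = a * D2 f x u w + D2 f x v w.
Proof. by move=> Dx; exact: derive_linear (df1 _ Dx). Qed.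

Lemma D3_syml x u v w : D x -> D3 f x u v w = D3 f x v u w.
Proof. by move=> Dx; exact: derive_sym oD (C2 _) Dx. Qed.

Lemma D3_symr x u v w : D x -> D3 f x u v w = D3 f x u w v.
Proof.
move=> Dx; apply: near_eq_derive.
have : nbhs x D by apply: open_nbhs_nbhs.
by apply: filterS => y Dy; exact: derive_sym oD C2f Dy.
Qed.

Lemma D3_linear x u v w z a : D x ->
  D3 f x (a *: u + v) w z = a * D3 f x u w z + D3 f x v w z.
Proof. by move=> Dx; exact: derive_linear (df2 _ _ Dx). Qed.

Lemma is_derive_D1 x h v (t : R) : D (x + t *: h) ->
  is_derive t 1 (fun t => 'D_v f (x + t *: h)) (D2 f (x + t *: h) h v).
Proof. by move=> Dx; exact: is_derive_line (df1 _ Dx). Qed.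

Lemma is_derive_D2 x h u v (t : R) : D (x + t *: h) ->
  is_derive t 1 (fun t => D2 f (x + t *: h) u v) (D3 f (x + t *: h) h u v).
Proof. by move=> Dx; exact: is_derive_line (df2 _ _ Dx). Qed.

Lemma dotv_grad x v : D x -> dotv (grad f x) v = 'D_v f x.
Proof.
move=> Dx; rewrite (derive_row _ (df Dx)) /dotv mxE.
by apply: eq_bigr => i _; rewrite !mxE mulrC.
Qed.

Lemma quad_hess x v : D x -> quad (hess f x) v = D2 f x v v.
Proof.
move=> Dx; rewrite [RHS](derive_row _ (df1 _ Dx)) /quad -mulmxA mxE.
apply: eq_bigr => i _; congr (_ * _); rewrite mxE.
(* [derive_row] expands only the outer derivative, so symmetry first brings [v] to the outside. *)
transitivity (D2 f x v (delta_mx 0 i)); last exact (D2_sym _ _ Dx).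
rewrite [RHS](derive_row _ (df1 _ Dx)); apply: eq_bigr => j _.
rewrite !mxE mulrC.
exact (congr1 (GRing.mul (v 0 j)) (D2_sym (delta_mx 0 i) (delta_mx 0 j) Dx)).
Qed.

Lemma derive1n_line x v (t : R) : D (x + t *: v) ->
  let p t := f (x + t *: v) in
  derive1n 2 p t = D2 f (x + t *: v) v v /\
  derive1n 3 p t = D3 f (x + t *: v) v v v.
Proof.
move=> Dt p.
(* The formula for each derivative of [p] must hold on a neighborhood before it can be
   differentiated again; openness of [D] provides one. *)
have nD s : D (x + s *: v) -> \forall r \near s, D (x + r *: v).
  move=> Ds; have c : {for s, continuous (fun r : R => x + r *: v)}.
    apply: continuousD; first exact: cst_continuous.
    exact: scalel_continuous.
  by apply: c; exact: open_nbhs_nbhs.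
have e1 s : D (x + s *: v) -> derive1n 1 p s = 'D_v f (x + s *: v).
  move=> Ds; rewrite derive1n1 derive1E.
  by have [_ ->] := is_derive_line (df Ds).
have e2 s : D (x + s *: v) -> derive1n 2 p s = D2 f (x + s *: v) v v.
  move=> Ds; rewrite derive1nS derive1E.
  have [_ <-] := is_derive_D1 v Ds; apply: near_eq_derive.
  by apply: filterS (nD s Ds) => r; exact: e1.
split; first exact: e2.
rewrite derive1nS derive1E.
have [_ <-] := is_derive_D2 v v Dt; apply: near_eq_derive.
by apply: filterS (nD t Dt) => r; exact: e2.
Qed.

End higher_derivatives.

Lemma powR3_2 (R : realType) (a : R) : 0 <= a -> a `^ (3 / 2) = Num.sqrt a ^+ 3.
Proof.
move=> a0; rewrite (_ : 3 / 2 = 2^-1 * 3%:R :> R); last by rewrite mulrC.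
by rewrite powRrM powR12_sqrt// powR_mulrn ?sqrtr_ge0.
Qed.

(** This is one-dimensional self-concordance along the line through [x] in direction [v], read at
    parameter 0. Positive definiteness gives the sign that turns the power 3/2 into the cube of a
    square root. *)
Lemma D3_bound_diag (R : realType) (n : nat) (D : set 'rV[R]_n)
    (f : 'rV[R]_n -> R) (x v : 'rV[R]_n) :
  self_concordant D f -> (forall x, D x -> posdef (hess f x)) -> D x ->
  `|D3 f x v v v| <= 2 * Num.sqrt (D2 f x v v) ^+ 3.
Proof.
move=> [oD _ _ f_C3 _ lines] f_posdef Dx.
have D0 : D (x + (0 : R) *: v) by rewrite scale0r addr0.
have [e2 e3] := derive1n_line oD f_C3 D0.
have := sc1_bound (lines x v Dx) D0; rewrite e2 e3 scale0r addr0.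
have B0 : 0 <= D2 f x v v.
  have [->|v0] := eqVneq v 0; first by rewrite /D2 derive0.
  by rewrite -(quad_hess oD f_C3 _ Dx); apply/ltW/f_posdef.
by rewrite (powR3_2 B0).
Qed.

(** * Symmetric trilinear forms *)

(** Triple-angle formulas at one third of [acos C]. Since [acos] reaches only the upper half circle,
    the case [S < 0] is reflected to it by changing the sign of [s]. *)
Lemma angle_trisection (R : realType) (C S : R) : C ^+ 2 + S ^+ 2 = 1 ->
  exists c s, [/\ c ^+ 2 + s ^+ 2 = 1, C = c ^+ 3 - 3 * c * s ^+ 2 &
    S = 3 * c ^+ 2 * s - s ^+ 3].
Proof.
wlog S0 : S / 0 <= S => [main CS|CS].
  have [S0|/ltW S0] := leP 0 S; first exact: main.
  have [||c [s [cs eC eS]]] := main (- S); rewrite ?oppr_ge0 ?sqrrN//.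
  by exists c, (- s); split; rewrite ?sqrrN// -[LHS]opprK eS; ring.
have C1 : -1 <= C <= 1 by nra.
pose g := acos C / 3; exists (cos g), (sin g).
have cs : sin g ^+ 2 = 1 - cos g ^+ 2 by rewrite -(cos2Dsin2 g); ring.
have g3 : acos C = g + g + g by rewrite /g; field.
have eC : cos (g + g + g) = C by rewrite -g3 acosK// in_itv.
have eS : sin (g + g + g) = S.
  rewrite -g3 sin_acos// (_ : 1 - C ^+ 2 = S ^+ 2) ?sqrtr_sqr ?ger0_norm//.
  by rewrite -CS; ring.
split; first by rewrite cs; ring.
- by rewrite -eC !cosD !sinD; ring: cs.
- by rewrite -eS sinD cosD sinD; ring: cs.
Qed.

(* M. Riesz interpolation: with [(C, S)] at angle [3 g], the linear form
   [a0 C + a1 S] is a convex combination of the values of the cubic form at the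
   angles [g + 2 pi j / 3], with weights [(4 cos^2 - 1)^2 / 9]. *)
Lemma cubic_form_bound (R : realType) (a0 a1 a2 a3 M : R) :
  (forall c s, c ^+ 2 + s ^+ 2 = 1 ->
    `|a0 * c ^+ 3 + 3 * a1 * c ^+ 2 * s + 3 * a2 * c * s ^+ 2 + a3 * s ^+ 3|
      <= M) ->
  forall C S, C ^+ 2 + S ^+ 2 = 1 -> `|a0 * C + a1 * S| <= M.
Proof.
set P := fun c s => a0 * c ^+ 3 + 3 * a1 * c ^+ 2 * s + 3 * a2 * c * s ^+ 2
  + a3 * s ^+ 3.
move=> PM C S /angle_trisection[c [s [cs -> ->]]].
have {}PM c' s' : c' ^+ 2 + s' ^+ 2 = 1 -> `|P c' s'| <= M by exact: PM.
pose q : R := Num.sqrt 3.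
have q2 : q ^+ 2 = 3 by rewrite sqr_sqrtr.
have s2 : s ^+ 2 = 1 - c ^+ 2 by rewrite -cs; ring.
(* With [q] the square root of 3, the points [(c1, s1)] and [(c2, s2')] are [(c, s)] rotated by the
   angles 2 pi / 3 and - 2 pi / 3. *)
pose c1 := - (c + q * s) / 2; pose s1 := - (s - q * c) / 2.
pose c2 := - (c - q * s) / 2; pose s2' := - (s + q * c) / 2.
have cs1 : c1 ^+ 2 + s1 ^+ 2 = 1 by rewrite /c1 /s1; field: q2 s2.
have cs2 : c2 ^+ 2 + s2' ^+ 2 = 1 by rewrite /c2 /s2'; field: q2 s2.
pose b (z : R) := (4 * z ^+ 2 - 1) ^+ 2 / 9.
have b0 z : 0 <= b z by rewrite /b divr_ge0// sqr_ge0.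
have bsum : b c + b c1 + b c2 = 1.
  by rewrite /b /c1 /c2; field: q2 s2.
have -> : a0 * (c ^+ 3 - 3 * c * s ^+ 2) + a1 * (3 * c ^+ 2 * s - s ^+ 3)
    = b c * P c s + b c1 * P c1 s1 + b c2 * P c2 s2'.
  by rewrite /P /b /c1 /c2 /s1 /s2'; field: q2 s2.
have bP z w : z ^+ 2 + w ^+ 2 = 1 -> `|b z * P z w| <= b z * M.
  by move=> zw; rewrite normrM (ger0_norm (b0 z)) ler_wpM2l// PM.
rewrite -[M]mul1r -bsum !mulrDl.
by rewrite !(le_trans (ler_normD _ _))// !lerD// ?bP//
  (le_trans (ler_normD _ _))// lerD// bP.
Qed.

Section symmetric_forms.
Context {R : realType} {V : lmodType R}.
Variable B : V -> V -> R.
Hypothesis Bsym : forall u v, B u v = B v u.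
Hypothesis Blin : forall a u v w, B (a *: u + v) w = a * B u w + B v w.
Hypothesis Bpos : forall u, u != 0 -> 0 < B u u.

Lemma form_linearr a u v w : B w (a *: u + v) = a * B w u + B w v.
Proof. by rewrite Bsym Blin !(Bsym w). Qed.

Lemma form_zerol w : B 0 w = 0.
Proof. by have := Blin 1 0 0 w; rewrite scaler0 addr0 mul1r; lra. Qed.

Lemma form_scalel a u w : B (a *: u) w = a * B u w.
Proof. by rewrite -[a *: u]addr0 Blin form_zerol addr0. Qed.

Lemma form_scaler a u w : B w (a *: u) = a * B w u.
Proof. by rewrite Bsym form_scalel Bsym. Qed.

Lemma form_ge0 u : 0 <= B u u.
Proof. by have [->|/Bpos/ltW//] := eqVneq u 0; rewrite form_zerol. Qed.

Lemma form_normZ a u : Num.sqrt (B (a *: u) (a *: u)) = `|a| * Num.sqrt (B u u).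
Proof.
by rewrite form_scalel form_scaler mulrA -expr2 sqrtrM ?sqr_ge0// sqrtr_sqr.
Qed.

Lemma form_normalize u : u != 0 ->
  B ((Num.sqrt (B u u))^-1 *: u) ((Num.sqrt (B u u))^-1 *: u) = 1.
Proof.
move=> /Bpos Bu; have N0 : Num.sqrt (B u u) != 0 by rewrite gt_eqF// sqrtr_gt0.
rewrite form_scalel form_scaler -[X in _ * (_ * X)]sqr_sqrtr ?ltW//; by field.
Qed.

Lemma form_CauchySchwarz u v : B u v <= Num.sqrt (B u u) * Num.sqrt (B v v).
Proof.
have [->|u0] := eqVneq u 0; first by rewrite form_zerol mulr_ge0 ?sqrtr_ge0.
have Bu := Bpos u0; rewrite -sqrtrM; last exact: form_ge0.
apply: (le_trans (ler_norm _)); rewrite -sqrtr_sqr ler_sqrt; last first.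
  by rewrite mulr_ge0 ?form_ge0.
(* This vector is the component of [v] orthogonal to [u]; multiplying by [B u u] clears the
   denominators. *)
have := form_ge0 ((- (B u v / B u u)) *: u + v).
rewrite Blin !form_linearr (Bsym v u) => h.
have : 0 <= B u u * (- (B u v / B u u) * (- (B u v / B u u) * B u u + B u v)
    + (- (B u v / B u u) * B u v + B v v)) by exact: mulr_ge0 (ltW Bu) h.
rewrite (_ : _ * _ = B u u * B v v - B u v ^+ 2) ?subr_ge0//.
by field; rewrite gt_eqF.
Qed.

Lemma form_triangle u v :
  Num.sqrt (B (u + v) (u + v)) <= Num.sqrt (B u u) + Num.sqrt (B v v).
Proof.
rewrite -(@ler_pXn2r _ 2) ?nnegrE ?addr_ge0 ?sqrtr_ge0// sqrrD.
rewrite !sqr_sqrtr ?form_ge0//.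
have := Blin 1 u v (u + v); rewrite scale1r mul1r => ->.
have := form_linearr 1 u v; rewrite scale1r => h; rewrite !h (Bsym v u).
by have := form_CauchySchwarz u v; lra.
Qed.

Variables (T : V -> V -> V -> R) (M : R).
Hypothesis Tsyml : forall u v w, T u v w = T v u w.
Hypothesis Tsymr : forall u v w, T u v w = T u w v.
Hypothesis Tlin : forall a u v w z,
  T (a *: u + v) w z = a * T u w z + T v w z.
Hypothesis Tdiag : forall u, `|T u u u| <= M * Num.sqrt (B u u) ^+ 3.

Let T0 w z : T 0 w z = 0.
Proof. by have := Tlin 1 0 0 w z; rewrite scaler0 addr0 mul1r; lra. Qed.

Let TZ a u w z : T (a *: u) w z = a * T u w z.
Proof. by rewrite -[a *: u]addr0 Tlin T0 addr0. Qed.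

Let Tlinm a u v w z : T w (a *: u + v) z = a * T w u z + T w v z.
Proof. by rewrite Tsyml Tlin !(Tsyml w). Qed.

Let Tlinr a u v w z : T w z (a *: u + v) = a * T w z u + T w z v.
Proof. by rewrite Tsymr Tlinm !(Tsymr w z). Qed.

Let TZm a u w z : T w (a *: u) z = a * T w u z.
Proof. by rewrite Tsyml TZ Tsyml. Qed.

Let TZr a u w z : T w z (a *: u) = a * T w z u.
Proof. by rewrite Tsymr TZm Tsymr. Qed.

(** On the plane spanned by the orthonormal pair [u], [e], the diagonal of [T] is a binary cubic
    form bounded by [M] on the unit circle. Then [cubic_form_bound] controls its first two
    coefficients, and homogeneity in [(a, b)] does the rest. *)
Lemma cubic_orthonormal_bound u e a b : B u u = 1 -> B e e = 1 -> B u e = 0 ->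
  `|T (a *: u + b *: e) u u| <= M * Num.sqrt (a ^+ 2 + b ^+ 2).
Proof.
move=> Bu Be Bue.
have key c s : c ^+ 2 + s ^+ 2 = 1 -> `|T u u u * c + T e u u * s| <= M.
  apply: (@cubic_form_bound _ _ _ (T u e e) (T e e e)) => {}c {}s cs.
  have := Tdiag (c *: u + s *: e).
  have -> : B (c *: u + s *: e) (c *: u + s *: e) = 1.
    rewrite Blin form_scalel !form_linearr !form_scaler (Bsym e u) Bu Be Bue.
    by rewrite -[RHS]cs; ring.
  rewrite sqrtr1 expr1n mulr1; apply: le_trans; rewrite le_eqVlt.
  apply/orP; left; apply/eqP; congr (`| _ |).
  rewrite !(Tlin, TZ, Tlinm, TZm, Tlinr, TZr).
  have -> : T u e u = T e u u by rewrite Tsyml.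
  have -> : T u u e = T e u u by rewrite Tsymr Tsyml.
  have -> : T e u e = T u e e by rewrite Tsyml.
  have -> : T e e u = T u e e by rewrite Tsymr Tsyml.
  by ring.
have [w0|w0] := eqVneq (Num.sqrt (a ^+ 2 + b ^+ 2)) 0.
  move: w0 => /eqP; rewrite sqrtr_eq0 => ab.
  have [-> ->] : a = 0 /\ b = 0 by split; nra.
  by rewrite !scale0r addr0 T0 normr0 expr0n/= addr0 sqrtr0 mulr0.
set w := Num.sqrt _ in w0 *.
have w_gt0 : 0 < w by rewrite lt_def w0 sqrtr_ge0.
have w2 : w ^+ 2 = a ^+ 2 + b ^+ 2.
  by rewrite sqr_sqrtr// addr_ge0// sqr_ge0.
have := key (a / w) (b / w).
have -> : (a / w) ^+ 2 + (b / w) ^+ 2 = 1.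
  by rewrite !expr_div_n -mulrDl -w2 divff// expf_neq0.
move=> /(_ erefl); rewrite Tlin !TZ.
have -> : T u u u * (a / w) + T e u u * (b / w)
    = (a * T u u u + b * T e u u) / w by field.
by rewrite normrM normfV (gtr0_norm w_gt0) ler_pdivrMr.
Qed.

(* Banach's theorem on symmetric trilinear forms: only the span of [h] and [v]
   matters, which reduces it to binary cubic forms. *)
Lemma trilinear_bound h v :
  `|T h v v| <= M * Num.sqrt (B h h) * B v v.
Proof.
have [->|v0] := eqVneq v 0.
  by rewrite Tsyml T0 form_zerol mulr0 normr0.
pose N := Num.sqrt (B v v); pose u := N^-1 *: v.
have Bu : B u u = 1 by exact: form_normalize.
have N0 : N != 0 by rewrite gt_eqF// sqrtr_gt0 Bpos.
have vE : v = N *: u by rewrite scalerA divff// scale1r.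
have N2 : B v v = N ^+ 2 by rewrite sqr_sqrtr// form_ge0.
have -> : T h v v = T h u u * N ^+ 2.
  by rewrite vE TZm TZr; ring.
rewrite N2 normrM [`|N ^+ 2|]ger0_norm ?sqr_ge0// ler_wpM2r ?sqr_ge0//.
(* Gram-Schmidt: [h] is split into its projection on [u] and an orthogonal remainder. *)
have [a [e [-> Bue]]] : exists a e, h = a *: u + e /\ B u e = 0.
  exists (B u h), ((- B u h) *: u + h); split.
    by rewrite addrA scaleNr subrr add0r.
  by rewrite form_linearr Bu mulr1 addNr.
have BhE : B (a *: u + e) (a *: u + e) = a ^+ 2 + B e e.
  by rewrite Blin !form_linearr (Bsym e u) Bue Bu; ring.
(* If [h] is parallel to [u], the remainder cannot be normalized, but the diagonal bound at [u]
   suffices. *)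
have [e0|e0] := eqVneq e 0.
  rewrite BhE e0 addr0 form_zerol addr0 TZ normrM sqrtr_sqr mulrC.
  rewrite ler_wpM2r//; have := Tdiag u.
  by rewrite Bu sqrtr1 expr1n mulr1.
pose b := Num.sqrt (B e e); pose e' := b^-1 *: e.
have b0 : b != 0 by rewrite gt_eqF// sqrtr_gt0 Bpos.
have eE : e = b *: e' by rewrite scalerA divff// scale1r.
rewrite BhE -[B e e]sqr_sqrtr ?form_ge0// -/b eE.
apply: cubic_orthonormal_bound => //; first exact: form_normalize.
by rewrite form_scaler Bue mulr0.
Qed.

End symmetric_forms.

(** * Differential inequalities on an interval *)

(** The hypothesis on [dp] says that the inverse square root of [p] has derivative at least -1, so
    adding [s] to it gives a nondecreasing function. Comparing its values at 0 and [t] and clearing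
    denominators gives the claim. *)
Lemma inv_sqrt_growth (R : realType) (p dp : R -> R) (t : R) : 0 <= t ->
  (forall s : R, 0 <= s <= t -> is_derive s 1 p (dp s)) ->
  (forall s : R, 0 <= s <= t -> 0 < p s) ->
  (forall s : R, 0 <= s <= t -> dp s <= 2 * Num.sqrt (p s) * p s) ->
  Num.sqrt (p t) * (1 - t * Num.sqrt (p 0)) <= Num.sqrt (p 0).
Proof.
move=> t0 pP p0 dpP; pose q s := Num.sqrt (p s).
have q0 s : 0 <= s <= t -> 0 < q s by move=> /p0; rewrite /q sqrtr_gt0.
have q2 s : 0 <= s <= t -> p s = q s ^+ 2.
  by move=> /p0/ltW ?; rewrite sqr_sqrtr.
pose w s := (q s)^-1 + s.
have : w 0 <= w t.
  apply: (@ge0_derive_le R w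
    (fun s : R => - (q s) ^- 2 * ((2 * q s)^-1 * dp s) + 1)) => // s st.
    apply: is_deriveD; apply: is_deriveV; first by rewrite gt_eqF ?q0.
    exact: (@is_derive1_comp _ _ _ _ _ _ (is_derive1_sqrt (p0 s st)) (pP s st)).
  have := dpP s st; rewrite -/(q s) q2// => h.
  have qs := q0 s st; rewrite mulNr addrC subr_ge0 mulrA -invfM.
  by rewrite mulrC ler_pdivrMr ?mul1r ?(le_trans h) ?mulr_gt0 ?exprn_gt0//; lra.
rewrite /w -/(q t) -/(q 0) addr0 => h.
have qt : 0 < q t by rewrite q0// t0 lexx.
have q00 : 0 < q 0 by rewrite q0// lexx.
have : (q 0)^-1 * (q 0 * q t) <= ((q t)^-1 + t) * (q 0 * q t).
  by rewrite ler_wpM2r// mulr_ge0 ?ltW.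
rewrite mulrA mulVf ?gt_eqF// mul1r.
rewrite (_ : (_ + _) * _ = q 0 + t * q 0 * q t); last by field; rewrite gt_eqF.
lra.
Qed.

Lemma affine_sqr_derive (R : realType) (r t : R) :
  is_derive t 1 (fun t : R => (1 - t * r) ^+ 2) (- (2 * r * (1 - t * r))).
Proof.
by apply: is_derive_eq; rewrite /GRing.scale/= ?mulr1n; ring.
Qed.

(** The logarithmic derivative of [p] is at most [2 * r / (1 - t * r)] in absolute value. In a form
    that also allows zeros of [p]: [p t * (1 - t * r) ^+ 2] is nonincreasing and
    [p t / (1 - t * r) ^+ 2] is nondecreasing. *)
Lemma log_derivative_bound (R : realType) (p dp : R -> R) (r : R) :
  0 <= r < 1 ->
  (forall t : R, 0 <= t <= 1 -> is_derive t 1 p (dp t)) ->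
  (forall t : R, 0 <= t <= 1 -> 0 <= p t) ->
  (forall t : R, 0 <= t <= 1 -> `|dp t| * (1 - t * r) <= 2 * r * p t) ->
  p 1 * (1 - r) ^+ 2 <= p 0 /\ p 0 * (1 - r) ^+ 2 <= p 1.
Proof.
move=> /andP[r0 r1] pP p0 dpP.
have u0 (t : R) : 0 <= t <= 1 -> 0 < 1 - t * r by nra.
split.
  rewrite -lerN2.
  have := @ge0_derive_le R (fun t : R => - (p t * (1 - t * r) ^+ 2))
   (fun t : R =>
     - (p t * - (2 * r * (1 - t * r)) + (1 - t * r) ^+ 2 * dp t)) 0 1.
  rewrite mul1r mul0r subr0 expr1n mulr1; apply=> // t t01.
    apply: is_deriveN; apply: is_deriveM; first exact: pP.
    exact: affine_sqr_derive.
  have h : dp t * (1 - t * r) <= 2 * r * p t.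
    apply: le_trans (dpP t t01); rewrite ler_wpM2r ?ler_norm//.
    by rewrite ltW ?u0.
  by have := ler_wpM2r (ltW (u0 t t01)) h; nra.
rewrite -ler_pdivlMr; last by rewrite exprn_gt0// subr_gt0.
have := @ge0_derive_le R (fun t : R => p t * ((1 - t * r) ^+ 2)^-1)
 (fun t : R => p t * (- ((1 - t * r) ^+ 2) ^- 2 * - (2 * r * (1 - t * r)))
   + ((1 - t * r) ^+ 2)^-1 * dp t) 0 1.
rewrite mul1r mul0r subr0 expr1n invr1 mulr1; apply=> // t t01.
  apply: is_deriveM; first exact: pP.
  apply: is_deriveV; first by rewrite expf_neq0// gt_eqF ?u0.
  exact: affine_sqr_derive.
have u := u0 t t01; set v := 1 - t * r in u *.
have h : - (dp t * v) <= 2 * r * p t.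
  apply: le_trans (dpP t t01); rewrite -mulNr ler_wpM2r ?(ltW u)//.
  by rewrite -normrN ler_norm.
rewrite (_ : _ + _ = (2 * r * p t + dp t * v) / v ^+ 3); last first.
  by field; rewrite gt_eqF.
by apply: divr_ge0; [lra|exact: exprn_ge0 (ltW u)].
Qed.

Lemma taylor2_bound (R : realType) (p dp ddp : R -> R) (K : R) :
  (forall t : R, 0 <= t <= 1 -> is_derive t 1 p (dp t)) ->
  (forall t : R, 0 <= t <= 1 -> is_derive t 1 dp (ddp t)) ->
  (forall t : R, 0 <= t <= 1 -> ddp t <= K) ->
  p 1 <= p 0 + dp 0 + K / 2.
Proof.
move=> pP dpP ddpP.
have dp_le (t : R) : 0 <= t <= 1 -> dp t <= dp 0 + t * K.
  move=> /andP[t0 t1].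
  suff : 0 * K - dp 0 <= t * K - dp t by lra.
  apply: (@ge0_derive_le R (fun t : R => t * K - dp t)
    (fun t : R => K - ddp t) 0 t t0).
    move=> s /andP[s0 st]; have s1 : 0 <= s <= 1 by rewrite s0 (le_trans st).
    have dps := dpP s s1; apply: is_derive_eq.
    by rewrite /GRing.scale/=; ring.
  by move=> s /andP[s0 st]; rewrite subr_ge0 ddpP// s0 (le_trans st).
suff : 0 * dp 0 + 0 ^+ 2 * (K / 2) - p 0 <= 1 * dp 0 + 1 ^+ 2 * (K / 2) - p 1.
  by rewrite !mul0r expr0n/= mul0r !mul1r expr1n mul1r; lra.
apply: (@ge0_derive_le R (fun t : R => t * dp 0 + t ^+ 2 * (K / 2) - p t)
  (fun t : R => dp 0 + t * K - dp t) 0 1 ler01).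
- move=> s s01; have ps := pP s s01; apply: is_derive_eq.
  by rewrite /GRing.scale/= ?mulr1n; field.
- by move=> s s01; rewrite subr_ge0 dp_le.
Qed.

(** * Local norms of self-concordant functions *)

Lemma convex_set_line (R : realType) (n : nat) (D : set 'rV[R]_n)
    (y h : 'rV[R]_n) (t : R) :
  convex_set (D : set (convex_lmodType 'rV[R]_n)) ->
  D y -> D (y + h) -> 0 <= t <= 1 -> D (y + t *: h).
Proof.
move=> cD Dy Dz /andP[t0 t1].
have := cD (y + h) y (Itv01 t0 t1); rewrite !inE => /(_ Dz Dy).
congr D; rewrite /conv/= /unstable.onem scalerDr scalerBl scale1r.
by rewrite [t *: y + _]addrC -addrA subrKC addrC.
Qed.

Lemma line_sub (R : realType) (n : nat) (x y : 'rV[R]_n) (t : R) :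
  x + t *: (y - x) - y = (- (1 - t)) *: (y - x).
Proof. by rewrite opprB scalerBl scale1r opprB addrAC addrC. Qed.

Lemma weight_bound (R : realType) (a b c r w : R) :
  0 <= w -> a * w <= r -> 0 <= b -> c <= 2 * a * b -> c * w <= 2 * r * b.
Proof.
move=> w0 aw b0 /(ler_wpM2r w0)/le_trans; apply.
have -> : 2 * a * b * w = 2 * (a * w) * b by ring.
by rewrite ler_wpM2r// ler_wpM2l.
Qed.

Lemma le_of_sqr_le (R : realType) (a b a2 b2 c : R) :
  0 <= a -> 0 <= b -> 0 <= c -> a ^+ 2 = a2 -> b ^+ 2 = b2 ->
  a2 * c ^+ 2 <= b2 -> a * c <= b.
Proof.
move=> a0 b0 c0 <- <-; rewrite -exprMn.
by rewrite ler_pXn2r// nnegrE mulr_ge0.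
Qed.

Lemma contraction_bound (R : realType) (a b r l : R) :
  0 <= a -> r <= l -> l < 1 -> a * (1 - r) <= b -> a <= b / (1 - l).
Proof.
move=> a0 rl l1; rewrite ler_pdivlMr ?subr_gt0//; apply: le_trans.
by rewrite ler_wpM2l// lerB.
Qed.

Lemma scaled_le (R : realType) (a l t : R) :
  0 <= t <= 1 -> 0 <= a -> a <= l -> `|1 - t| * a <= l.
Proof. by move=> /andP[t0 t1] a0 al; rewrite ger0_norm ?subr_ge0//; nra. Qed.

Lemma le_div_onem (R : realType) (a b l : R) :
  a <= b / (1 - l) -> b <= l -> l < 1 -> a <= l / (1 - l).
Proof.
move=> ab bl l1; apply: (le_trans ab).
by rewrite ler_pM2r// invr_gt0 subr_gt0.
Qed.

Lemma trilinear_weight (R : realType) (a b A C : R) :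
  0 <= a -> 0 <= b -> a <= A -> b <= C -> 2 * b * a ^+ 2 <= 2 * A ^+ 2 * C.
Proof.
move=> a0 b0 aA bC.
have a2A2 : a ^+ 2 <= A ^+ 2.
  by rewrite ler_pXn2r ?nnegrE ?(le_trans a0).
have := ler_pM b0 (sqr_ge0 a) bC a2A2; lra.
Qed.

Lemma taylor_rearrange (R : realType) (p q r l d : R) : l < 1 ->
  q <= p + r + 2 * (l / (1 - l)) ^+ 2 * (d / (1 - l)) / 2 ->
  q - p - r <= l ^+ 2 * d / (1 - l) ^+ 3.
Proof.
move=> l1; rewrite (_ : _ / 2 = l ^+ 2 * d / (1 - l) ^+ 3); first by lra.
by field; rewrite subr_eq0 gt_eqF.
Qed.

(** The local norm in terms of directional derivatives instead of the Hessian matrix, so that the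
    results on abstract forms apply to it; [local_normE] identifies the two on [D]. *)
Definition hess_norm (R : realType) (n : nat) (f : 'rV[R]_n -> R)
  (x v : 'rV[R]_n) : R := Num.sqrt (D2 f x v v).

Section self_concordant_theory.
Context {R : realType} {n : nat} {D : set 'rV[R]_n} {f : 'rV[R]_n -> R}.
Hypotheses (f_sc : self_concordant D f).
Hypothesis f_posdef : forall x, D x -> posdef (hess f x).
Implicit Types x y z u v w h : 'rV[R]_n.

Let oD : open D. Proof. exact: sc_open f_sc. Qed.
Let f_C3 : Ck 3 D f. Proof. exact: sc_C3 f_sc. Qed.

Lemma local_normE x v : D x -> local_norm f x v = hess_norm f x v.
Proof. by move=> Dx; rewrite /local_norm (quad_hess oD f_C3 _ Dx). Qed.

Lemma D2_gt0 x v : D x -> v != 0 -> 0 < D2 f x v v.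
Proof. by move=> Dx v0; rewrite -(quad_hess oD f_C3 _ Dx); exact: f_posdef. Qed.

Lemma D2_ge0 x v : D x -> 0 <= D2 f x v v.
Proof.
move=> Dx.
exact: (@form_ge0 R _ (D2 f x) (fun a u v w => D2_linear f_C3 u v w a Dx)
  (fun u => @D2_gt0 x u Dx)).
Qed.

Lemma hess_norm_ge0 x v : 0 <= hess_norm f x v.
Proof. exact: sqrtr_ge0. Qed.

Lemma hess_norm_sqr x v : D x -> hess_norm f x v ^+ 2 = D2 f x v v.
Proof. by move=> Dx; rewrite sqr_sqrtr// D2_ge0. Qed.

Lemma hess_normZ x a v : D x -> hess_norm f x (a *: v) = `|a| * hess_norm f x v.
Proof.
move=> Dx.
exact: (@form_normZ R _ (D2 f x) (fun u v => D2_sym oD f_C3 u v Dx)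
  (fun a u v w => D2_linear f_C3 u v w a Dx)).
Qed.

Lemma hess_normN x v : D x -> hess_norm f x (- v) = hess_norm f x v.
Proof. by move=> Dx; rewrite -scaleN1r hess_normZ// normrN normr1 mul1r. Qed.

Lemma ler_hess_normD x u v : D x ->
  hess_norm f x (u + v) <= hess_norm f x u + hess_norm f x v.
Proof.
move=> Dx.
exact: (@form_triangle R _ (D2 f x) (fun u v => D2_sym oD f_C3 u v Dx)
  (fun a u v w => D2_linear f_C3 u v w a Dx) (fun u => @D2_gt0 x u Dx)).
Qed.

Lemma D3_bound x h v : D x ->
  `|D3 f x h v v| <= 2 * hess_norm f x h * hess_norm f x v ^+ 2.
Proof.
move=> Dx; rewrite (hess_norm_sqr _ Dx).
apply: (@trilinear_bound R _ (D2 f x) _ _ _ (D3 f x) 2).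
- by move=> u w; exact: (D2_sym oD f_C3 u w Dx).
- by move=> a u w z; exact: (D2_linear f_C3 u w z a Dx).
- by move=> u; exact: D2_gt0.
- by move=> u w z; exact: (D3_syml oD f_C3 u w z Dx).
- by move=> u w z; exact: (D3_symr oD f_C3 u w z Dx).
- by move=> a u w z s; exact: (D3_linear f_C3 u w z s a Dx).
- by move=> u; exact: (D3_bound_diag u f_sc f_posdef Dx).
Qed.

Lemma hess_norm_line y h t : D y -> D (y + h) -> 0 <= t <= 1 ->
  hess_norm f (y + t *: h) h * (1 - t * hess_norm f y h) <= hess_norm f y h.
Proof.
move=> Dy Dz /andP[t0 t1].
(* [inv_sqrt_growth] requires a positive function, hence [h != 0]. *)
have [->|hn0] := eqVneq h 0.
  by rewrite /hess_norm /D2 !derive0 sqrtr0 mul0r.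
have Ds s : 0 <= s <= t -> D (y + s *: h).
  move=> /andP[s0 st]; apply: convex_set_line => //.
    exact: sc_convex_dom f_sc.
  by rewrite s0 (le_trans st).
have := @inv_sqrt_growth R (fun s : R => D2 f (y + s *: h) h h)
  (fun s : R => D3 f (y + s *: h) h h h) t t0.
rewrite scale0r addr0; apply=> s /Ds Dsh.
- exact: (is_derive_D2 f_C3 h h Dsh).
- exact: D2_gt0.
- apply: (le_trans (ler_norm _)).
  by have := D3_bound h h Dsh; rewrite (hess_norm_sqr _ Dsh).
Qed.

(** Along the segment, [D3_bound] bounds the derivative of [D2 f _ v v] by twice the current norm of
    [h] times the function itself, and [hess_norm_line] bounds that norm by [r / (1 - t * r)], where
    [r] is the norm of [h] at [y]. This is the situation of [log_derivative_bound]. *)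
Lemma hess_norm_compare y z v : D y -> D z -> hess_norm f y (z - y) < 1 ->
  hess_norm f z v * (1 - hess_norm f y (z - y)) <= hess_norm f y v /\
  hess_norm f y v * (1 - hess_norm f y (z - y)) <= hess_norm f z v.
Proof.
move=> Dy Dz; set h := z - y => h1.
have zE : z = y + h by rewrite addrC subrK.
have Dt t : 0 <= t <= 1 -> D (y + t *: h).
  by apply: convex_set_line => //; [exact: sc_convex_dom f_sc | rewrite -zE].
have h1' : 0 <= 1 - hess_norm f y h by rewrite subr_ge0 ltW.
have r01 : 0 <= hess_norm f y h < 1 by rewrite hess_norm_ge0.
have := @log_derivative_bound R (fun t : R => D2 f (y + t *: h) v v)
  (fun t : R => D3 f (y + t *: h) h v v) (hess_norm f y h) r01.
rewrite scale0r addr0 scale1r -zE => /(_ _ _ _)[|||A B].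
- by move=> t /Dt Dth; exact: (is_derive_D2 f_C3 v v Dth).
- by move=> t /Dt; exact: D2_ge0.
- move=> t t01; have Dth := Dt t t01.
  have hl :
      hess_norm f (y + t *: h) h * (1 - t * hess_norm f y h) <= hess_norm f y h.
    by apply: hess_norm_line; rewrite -?zE.
  have t1 : 0 <= 1 - t * hess_norm f y h.
    move: t01 => /andP[t0 t1]; rewrite subr_ge0 mulr_ile1 ?hess_norm_ge0//.
    exact: ltW.
  have := D3_bound h v Dth; rewrite (hess_norm_sqr _ Dth) => hD3.
  exact: weight_bound t1 hl (D2_ge0 v Dth) hD3.
split.
- exact (le_of_sqr_le (hess_norm_ge0 z v) (hess_norm_ge0 y v) h1'
    (hess_norm_sqr v Dz) (hess_norm_sqr v Dy) A).
- exact (le_of_sqr_le (hess_norm_ge0 y v) (hess_norm_ge0 z v) h1'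
    (hess_norm_sqr v Dy) (hess_norm_sqr v Dz) B).
Qed.

(* The path runs towards the base point [y] of the norm, so along it the local
   norms stay within the factor [1 - l] of [hess_norm f y]. *)
Lemma gradient_bound x y d (l : R) : D x -> D y ->
  hess_norm f y (x - y) <= l -> l < 1 ->
  'D_d f y - 'D_d f x - D2 f x (y - x) d <=
    l ^+ 2 * hess_norm f y d / (1 - l) ^+ 3.
Proof.
move=> Dx Dy; rewrite -opprB (hess_normN _ Dy); set h := y - x => hl l1.
have Dxh : D (x + h) by rewrite /h subrKC.
have Dt t := @convex_set_line R n D x h t (sc_convex_dom f_sc) Dx Dxh.
have tl (t : R) : 0 <= t <= 1 -> hess_norm f y (x + t *: h - y) <= l.
  move=> t01; rewrite line_sub (hess_normZ _ _ Dy) -/h normrN.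
  exact (scaled_le t01 (hess_norm_ge0 y h) hl).
(* [K] is the bound of [D3_bound] with direction [d] and repeated argument [h], each of the three
   norms being enlarged by [1 / (1 - l)] in passing from [y] to a point of the path. *)
pose K := 2 * (l / (1 - l)) ^+ 2 * (hess_norm f y d / (1 - l)).
have B : 'D_d f (x + 1 *: h) <=
    'D_d f (x + 0 *: h) + D2 f (x + 0 *: h) h d + K / 2.
  apply: (@taylor2_bound R (fun t : R => 'D_d f (x + t *: h))
    (fun t : R => D2 f (x + t *: h) h d)
    (fun t : R => D3 f (x + t *: h) h h d) K) => t t01; have Dth := Dt t t01.
  - exact: (is_derive_D1 f_C3 d Dth).
  - exact: (is_derive_D2 f_C3 h d Dth).
  - have cmp v : hess_norm f (x + t *: h) v <= hess_norm f y v / (1 - l).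
      have r1 := le_lt_trans (tl t t01) l1.
      have [c _] := hess_norm_compare v Dy Dth r1.
      exact (contraction_bound (hess_norm_ge0 _ _) (tl t t01) l1 c).
    have := D3_bound d h Dth.
    rewrite -(D3_syml oD f_C3 h d h Dth) -(D3_symr oD f_C3 h h d Dth) => hD3.
    apply: (le_trans (ler_norm _)); apply: (le_trans hD3).
    have ch := le_div_onem (cmp h) hl l1.
    exact (trilinear_weight (hess_norm_ge0 _ _) (hess_norm_ge0 _ _) ch (cmp d)).
move: B; rewrite scale0r addr0 scale1r subrKC => B.
exact: taylor_rearrange l1 B.
Qed.

End self_concordant_theory.

(** * Optimality conditions *)

(** The smooth part contributes its derivative [d], the convex part only its chord slope [a]. If
    [d + a] were negative, difference quotients of [p] at small positive [h] would fall below [- a],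
    against the second hypothesis. *)
Lemma ge0_right_derive (R : realType) (p : R -> R) (d a : R) :
  is_derive (0 : R) 1 p d ->
  (forall t : R, 0 <= t <= 1 -> p 0 <= p t + t * a) ->
  0 <= d + a.
Proof.
move=> [dp dE] pmin; rewrite leNgt; apply/negP => da0.
have : h^-1 *: ((p \o shift 0) (h *: 1) - p 0) @[h --> 0^'] --> d.
  by rewrite -dE.
move=> /cvgrPdist_lt/(_ (- (d + a))); rewrite oppr_gt0 => /(_ da0).
move=> /nbhs_ballP[e /= e0 eP].
pose h := Num.min (e / 2) 1.
have h0 : 0 < h by rewrite lt_min ltr01 andbT divr_gt0.
have he : h < e.
  by rewrite gt_min; apply/orP; left; rewrite ltr_pdivrMr// ltr_pMr// ltr1n.
have h1 : h <= 1 by rewrite ge_min lexx orbT.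
have : ball (0 : R) e h by rewrite -ball_normE /= sub0r normrN gtr0_norm.
move=> /eP/(_ (lt0r_neq0 h0)); rewrite /= [h *: 1]mulr1 addr0.
rewrite ltr_norml => /andP[+ _].
have := pmin h; rewrite h1 (ltW h0) => /(_ isT) ph.
have : - a <= h^-1 *: (p h - p 0).
  by rewrite [_ *: _]mulrC ler_pdivlMr//; lra.
lra.
Qed.

Section composite_minimizers.
Context {R : realType} {n : nat} {D : set 'rV[R]_n} {g : 'rV[R]_n -> \bar R}.
Hypothesis cD : convex_set (D : set (convex_lmodType 'rV[R]_n)).
Hypotheses (g_proper : eproper g) (g_convex : econvex g).
Implicit Types (x z : 'rV[R]_n) (s : 'rV[R]_n -> R).

Lemma edom_fine x : edom g x -> g x = (fine (g x))%:E.
Proof. by move=> gx; rewrite fineK// fin_numE -ltey -ltNye gx g_proper.1. Qed.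

Lemma fine_convex x z (t : R) : edom g x -> edom g z -> 0 <= t <= 1 ->
  edom g (x + t *: (z - x)) /\
  fine (g (x + t *: (z - x))) <= fine (g x) + t * (fine (g z) - fine (g x)).
Proof.
move=> gx gz t01; have := g_convex z x t01.
rewrite (_ : t *: z + _ = x + t *: (z - x)); last first.
  by rewrite scalerBl scale1r scalerBr addrCA.
rewrite (edom_fine gx) (edom_fine gz) -!EFinM -EFinD => h.
have gt : edom g (x + t *: (z - x)) by apply: (le_lt_trans h); rewrite ltry.
split=> //; move: h; rewrite (edom_fine gt) lee_fin /=; lra.
Qed.

(** Convexity replaces [g] on the segment by its chord. The smooth part [s] is left general in order
    to serve both [f] and the quadratic model. *)
Lemma minimizer_line s (c : R) x z (t : R) : 0 < c ->
  minimizer (domF D g) (fun x => ((s x)%:E + (c^-1)%:E * g x)%E) x ->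
  domF D g z -> 0 <= t <= 1 ->
  s x <= s (x + t *: (z - x)) + t * ((fine (g z) - fine (g x)) / c).
Proof.
move=> c0 [[Dx gx] xmin] [Dz gz] t01.
have [gt gt_le] := fine_convex gx gz t01.
have Dt : D (x + t *: (z - x)).
  by apply: (convex_set_line cD) => //; rewrite subrKC.
have := xmin _ (conj Dt gt).
rewrite (edom_fine gx) (edom_fine gt) -!EFinM -!EFinD lee_fin.
have := ler_wpM2l (ltW (_ : 0 < c^-1)) gt_le; rewrite invr_gt0 => /(_ c0).
lra.
Qed.

End composite_minimizers.

(** The quotients by [t] are opposite and cancel in the sum; this eliminates [g] from the two
    optimality inequalities. *)
Lemma variational_sum (R : realFieldType) (a b d e p q t : R) :
  0 <= b + (p - q) / t -> 0 <= - a - (d + e) + (q - p) / t -> d <= b - a - e.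
Proof. by lra. Qed.

(** * Variational inequalities and the proximal-Newton step *)

Section proximal_newton.
Context {R : realType} {n : nat} {D : set 'rV[R]_n} {f : 'rV[R]_n -> R}.
Context {g : 'rV[R]_n -> \bar R}.
Hypotheses (f_sc : self_concordant D f).
Hypothesis f_posdef : forall x, D x -> posdef (hess f x).
Hypotheses (g_proper : eproper g) (g_convex : econvex g).
Implicit Types x y z : 'rV[R]_n.

Let oD : open D. Proof. exact: sc_open f_sc. Qed.
Let f_C3 : Ck 3 D f. Proof. exact: sc_C3 f_sc. Qed.
Let cD := sc_convex_dom f_sc.

Lemma minimizer_variational (t : R) y z : 0 < t ->
  minimizer (domF D g) (F f g t) y -> domF D g z ->
  0 <= 'D_(z - y) f y + (fine (g z) - fine (g y)) / t.
Proof.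
move=> t0 ymin Dz.
have Dy : D y by case: ymin => -[].
apply: (@ge0_right_derive R (fun r : R => f (y + r *: (z - y)))).
  have := @is_derive_line R n f y (z - y) 0; rewrite scale0r addr0; apply.
  by case: f_C3 => + _; exact.
move=> r r01; rewrite scale0r addr0.
exact: (minimizer_line cD g_proper g_convex t0 ymin Dz r01).
Qed.

(** The smooth part of [Fhat], rewritten with directional derivatives. *)
Definition model y x : R :=
  f y + 'D_(x - y) f y + 2^-1 * D2 f y (x - y) (x - y).

Lemma Fhat_model (t : R) y x : D y ->
  Fhat f g t y x = ((model y x)%:E + (t^-1)%:E * g x)%E.
Proof.
by move=> Dy; rewrite /Fhat (dotv_grad f_C3 _ Dy) (quad_hess oD f_C3 _ Dy).
Qed.

Lemma model_line y x h (r : R) : D y ->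
  model y (x + r *: h) = model y x + r * ('D_h f y + D2 f y (x - y) h)
    + r ^+ 2 * (2^-1 * D2 f y h h).
Proof.
move=> Dy; rewrite /model.
have -> : x + r *: h - y = r *: h + (x - y) by rewrite addrAC addrC.
have df : differentiable f y by case: f_C3 => + _; exact.
have lin a u v w := D2_linear f_C3 u v w a Dy.
have sym u v := D2_sym oD f_C3 u v Dy.
rewrite (derive_linear _ _ _ df) lin.
rewrite (form_linearr sym lin) (form_linearr sym lin) (sym h (x - y)).
move: ('D_h f y) ('D_(x - y) f y) (D2 f y h h) (D2 f y (x - y) h) => a b c d.
by field.
Qed.

Lemma model_variational (t : R) y x z : 0 < t -> D y ->
  minimizer (domF D g) (Fhat f g t y) x -> domF D g z ->
  0 <= 'D_(z - x) f y + D2 f y (x - y) (z - x)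
     + (fine (g z) - fine (g x)) / t.
Proof.
move=> t0 Dy.
rewrite (funext (fun x => Fhat_model t x Dy)) => xmin Dz.
have := minimizer_line cD g_proper g_convex t0 xmin Dz.
move: ((fine (g z) - fine (g x)) / t) => G.
set a := 'D_(z - x) f y + D2 f y (x - y) (z - x).
set b := 2^-1 * D2 f y (z - x) (z - x) => line.
apply: (@ge0_right_derive R (fun r : R => r * a + r ^+ 2 * b)).
  apply: is_derive_eq.
  by rewrite /GRing.scale/= ?mulr1n; ring.
move=> r r01; have := line r r01; rewrite (model_line _ _ _ Dy) -/a -/b.
move: a b (model y x) => {line} a b m.
by rewrite mul0r expr0n/= mul0r; lra.
Qed.

(** Expanding the model around [xbar], the linear term plus the change in [g] is nonnegative by
    optimality, so the gap of at most [delta ^+ 2 / 2] dominates half the squared norm of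
    [x - xbar]. *)
Lemma delta_solution_dist (t delta : R) y xbar x : 0 < t -> 0 <= delta -> D y ->
  minimizer (domF D g) (Fhat f g t y) xbar ->
  delta_solution D f g t y xbar delta x ->
  hess_norm f y (x - xbar) <= delta.
Proof.
move=> t0 delta0 Dy xmin [Dx].
rewrite !(Fhat_model _ _ Dy) (edom_fine g_proper Dx.2).
rewrite (edom_fine g_proper xmin.1.2) -!EFinM -!EFinD lee_fin.
have := model_variational t0 Dy xmin Dx.
have := model_line xbar (x - xbar) 1 Dy.
rewrite scale1r subrKC => ->; rewrite -(hess_norm_sqr f_sc f_posdef _ Dy).
move: (hess_norm_ge0 (f := f) y (x - xbar)).
move: (hess_norm f y (x - xbar)) ('D_(x - xbar) f y).
move: (D2 f y (xbar - y) (x - xbar)).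
move: (model y xbar) (fine (g x)) (fine (g xbar)) => m u v b p a p0 h1 h2.
have : p ^+ 2 <= delta ^+ 2 by lra.
by rewrite ler_pXn2r.
Qed.

(** The optimality of [y] is tested at [xbar] and that of [xbar] at [y]. What remains of the sum is
    the linearization error of the gradient in direction [xbar - y], estimated by
    [gradient_bound]. *)
Lemma exact_step_bound (t l : R) x y xbar : 0 < t -> D x ->
  minimizer (domF D g) (F f g t) y ->
  minimizer (domF D g) (Fhat f g t x) xbar ->
  hess_norm f y (x - y) <= l -> l < 1 ->
  hess_norm f x (xbar - y) ^+ 2
    <= l ^+ 2 * hess_norm f y (xbar - y) / (1 - l) ^+ 3.
Proof.
move=> t0 Dx ymin xmin hl l1.
have Dy : D y by case: ymin => -[].
apply: le_trans (gradient_bound f_sc f_posdef (xbar - y) Dx Dy hl l1).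
have h1 := minimizer_variational t0 ymin xmin.1.
have h2 := model_variational t0 Dx xmin ymin.1.
rewrite (hess_norm_sqr f_sc f_posdef _ Dx).
have df : differentiable f x by case: f_C3 => + _; exact.
have lin a u v w := D2_linear f_C3 u v w a Dx.
have sym u v := D2_sym oD f_C3 u v Dx.
have LN : 'D_(y - xbar) f x = - 'D_(xbar - y) f x.
  by rewrite -opprB !deriveE// linearN.
have BN : D2 f x (xbar - x) (y - xbar) =
    - (D2 f x (xbar - y) (xbar - y) + D2 f x (y - x) (xbar - y)).
  have -> : y - xbar = (-1) *: (xbar - y) by rewrite scaleN1r opprB.
  rewrite (form_scaler sym lin) mulN1r.
  (* This splitting isolates the squared norm of [xbar - y] at [x]. *)
  have -> : xbar - x = 1 *: (xbar - y) + (y - x) by rewrite scale1r addrA subrK.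
  by rewrite lin mul1r.
move: h1 h2; rewrite LN BN.
exact: variational_sum.
Qed.

End proximal_newton.

(** * Numerical estimates *)

(** The bound [s ^+ 2 / (1 - r) + r] increases with [r], so [r] may be replaced by its largest value
    [m]. The slack is then a positive multiple of [(1 + c ^+ 2) * (1 + s ^+ 2) - (c + s) ^+ 2 = (c *
    s - 1) ^+ 2]. *)
Lemma predictor_bound (R : realType) (a s r c : R) : 0 < c -> 0 < s ->
  r <= (s - c * s ^+ 2) / (c + s) ->
  r < 1 /\ (a * (1 - r) <= s ^+ 2 -> a + r <= 1 / c * s).
Proof.
move=> c0 s0; pose m := (s - c * s ^+ 2) / (c + s); rewrite -/m => rm.
have cs0 : 0 < c + s by lra.
have s20 : 0 < s ^+ 2 by rewrite exprn_gt0.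
have m1 : 1 - m = c * (1 + s ^+ 2) / (c + s).
  by rewrite /m; field; rewrite gt_eqF.
have m10 : 0 < 1 - m by rewrite m1 !mulr_gt0 ?invr_gt0// addr_gt0.
split=> [|ar]; first by lra.
have am : a <= s ^+ 2 / (1 - m).
  have [a0|a0] := leP a 0; first by rewrite (le_trans a0)// divr_ge0 ?ltW.
  by rewrite ler_pdivlMr// (le_trans _ ar)// ler_pM2l//; lra.
apply: (@le_trans _ _ (s ^+ 2 / (1 - m) + m)); first by rewrite lerD.
rewrite m1 -subr_ge0.
have -> : 1 / c * s - (s ^+ 2 / (c * (1 + s ^+ 2) / (c + s)) + m) =
    s ^+ 2 * (c * s - 1) ^+ 2 / (c * (c + s) * (1 + s ^+ 2)).
  rewrite /m; field; rewrite !gt_eqF//=.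
  by rewrite addr_gt0.
have den_gt0 : 0 < c * (c + s) * (1 + s ^+ 2) by rewrite !mulr_gt0 ?addr_gt0.
exact: divr_ge0 (mulr_ge0 (ltW s20) (sqr_ge0 _)) (ltW den_gt0).
Qed.

Lemma scaled_sqrt_lt1 (R : realType) (s : R) :
  0 < s -> s ^+ 2 <= 15 / 100 -> 1 / (2581 / 1000) * s < 1.
Proof. by move=> s0 s15; nra. Qed.

(** Here [p] is the inexactness and [q] the error of the exact step. From [l <= 0.16] one gets
    [p <= 0.09 * s ^+ 2], since 0.075 / 0.84 < 0.09, and [q <= 0.4 * s ^+ 2], since
    [l ^+ 2 <= 0.151 * s ^+ 2] and [(1 - l) ^+ 5 >= 0.4]. *)
Lemma corrector_bound (R : realType) (l p q s delta : R) :
  0 <= l -> 0 <= p -> 0 <= q -> 0 <= s -> s ^+ 2 <= 15 / 100 ->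
  l <= 1 / (2581 / 1000) * s -> delta <= 75 / 1000 * s ^+ 2 ->
  p * (1 - l) <= delta ->
  (q * (1 - l)) ^+ 2 <= l ^+ 2 * q / (1 - l) ^+ 3 ->
  p + q <= s ^+ 2.
Proof.
move=> l0 p0 q0 s0 s15 ls ds pl ql.
have l2 : l ^+ 2 <= 151 / 1000 * s ^+ 2.
  have h : 1 / (2581 / 1000) * s <= 388 / 1000 * s by nra.
  by nra.
have l16 : l <= 16 / 100 by nra.
set u := 1 - l in pl ql; have u84 : 84 / 100 <= u by rewrite /u; lra.
have u0 : 0 < u by lra.
have pb : p <= 90 / 1000 * s ^+ 2 by nra.
have qb : q <= 40 / 100 * s ^+ 2.
  have [->|qn0] := eqVneq q 0; first by nra.
  have q_gt0 : 0 < q by rewrite lt_def qn0.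
  move: ql; rewrite ler_pdivlMr ?exprn_gt0// => ql.
  have u2 : 7 / 10 <= u ^+ 2 by nra.
  have u5 : 4 / 10 <= u ^+ 2 * u ^+ 3.
    have -> : u ^+ 2 * u ^+ 3 = u ^+ 2 * u ^+ 2 * u by ring.
    have u4 : 49 / 100 <= u ^+ 2 * u ^+ 2 by nra.
    by have := ler_pM _ _ u4 u84; lra.
  (* Both sides of [ql] contain a factor [q]; cancelling it leaves a bound linear in [q]. *)
  have : q * (u ^+ 2 * u ^+ 3) <= l ^+ 2.
    rewrite -(ler_pM2l q_gt0) [leRHS]mulrC; apply: le_trans ql.
    by rewrite exprMn expr2 !mulrA.
  by nra.
lra.
Qed.

(** * One step of the path-following scheme *)

Theorem theorem4p1 (R : realType) (n : nat)
  (D : set 'rV[R]_n) (f : 'rV[R]_n -> R) (g : 'rV[R]_n -> \bar R) (nu : R)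
  (f_barrier : sc_barrier nu D f)
  (f_posdef : forall x, D x -> posdef (hess f x))
  (g_proper : eproper g)
  (g_lsc : lower_semicontinuous g)
  (g_convex : econvex g)
  (t0 t1 : R) (t0_gt0 : 0 < t0) (t1_gt0 : 0 < t1)
  (xs0 xs1 : 'rV[R]_n)
  (xs0_min : minimizer (domF D g) (F f g t0) xs0)
  (xs1_min : minimizer (domF D g) (F f g t1) xs1)
  (x0 : 'rV[R]_n) (x0_dom : domF D g x0)
  (xbar : 'rV[R]_n)
  (xbar_min : minimizer (domF D g) (Fhat f g t1 x0) xbar)
  (delta : R) (delta_ge0 : 0 <= delta)
  (x1 : 'rV[R]_n) (x1_sol : delta_solution D f g t1 x0 xbar delta x1)
  (beta : R) (beta_gt0 : 0 < beta) (beta_le : beta <= 15 / 100)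
  (delta_le : delta <= 75 / 1000 * beta)
  (Delta_le : local_norm f xs1 (xs1 - xs0)
     <= (Num.sqrt beta - 2581 / 1000 * beta) / (2581 / 1000 + Num.sqrt beta)) :
  local_norm f xs0 (x0 - xs0) <= beta ->
  local_norm f xs1 (x0 - xs1) <= 1 / (2581 / 1000) * Num.sqrt beta /\
  local_norm f xs1 (x1 - xs1) <= beta.
Proof.
move=> lam0.
have f_sc := scb_sc f_barrier.
have [Dx0 Dxs0 Dxs1] : [/\ D x0 , D xs0 & D xs1].
  by case: x0_dom xs0_min xs1_min => ? _ [[? _] _] [[? _] _].
pose s := Num.sqrt beta; rewrite -/s in Delta_le *.
have s_gt0 : 0 < s by rewrite sqrtr_gt0.
have s2 : s ^+ 2 = beta by rewrite sqr_sqrtr// ltW.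
(* Writing [beta] as [s ^+ 2] makes all numerical estimates rational in [s]. *)
rewrite -s2 in Delta_le delta_le beta_le lam0 *.
rewrite (local_normE f_sc (xs1 - xs0) Dxs1) in Delta_le.
rewrite (local_normE f_sc (x0 - xs0) Dxs0) in lam0.
have c_gt0 : 0 < 2581 / 1000 :> R by rewrite divr_gt0 ?ltr0n.
have [Delta1 pred] :=
  predictor_bound (hess_norm f xs1 (x0 - xs0)) c_gt0 s_gt0 Delta_le.
have D01 : hess_norm f xs1 (xs0 - xs1) = hess_norm f xs1 (xs1 - xs0).
  by rewrite -opprB (hess_normN f_sc).
have lam1 : hess_norm f xs1 (x0 - xs1) <= 1 / (2581 / 1000) * s.
  rewrite -D01 in Delta1 pred.
  (* [lam0] is measured at [xs0]; the comparison based at [xs1] transfers it there at the cost of a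
     factor [1 - Delta]. *)
  have [_ cmp] := hess_norm_compare f_sc f_posdef (x0 - xs0) Dxs1 Dxs0 Delta1.
  apply: le_trans (pred (le_trans cmp lam0)).
  have := ler_hess_normD f_sc f_posdef (x0 - xs0) (xs0 - xs1) Dxs1.
  by rewrite addrA subrK.
split; first by rewrite (local_normE f_sc (x0 - xs1) Dxs1).
rewrite (local_normE f_sc (x1 - xs1) Dxs1).
have l1 : hess_norm f xs1 (x0 - xs1) < 1.
  by apply: le_lt_trans lam1 _; exact: scaled_sqrt_lt1 s_gt0 beta_le.
(* The inexactness and the exact step are controlled in the norm at [x0], where the subproblem
   lives; both are carried over to the norm at [xs1]. *)
have [_ cmpp] := hess_norm_compare f_sc f_posdef (x1 - xbar) Dxs1 Dx0 l1.
have [_ cmpq] := hess_norm_compare f_sc f_posdef (xbar - xs1) Dxs1 Dx0 l1.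
have dist := delta_solution_dist f_sc f_posdef g_proper g_convex t1_gt0
  delta_ge0 Dx0 xbar_min x1_sol.
have step := exact_step_bound f_sc f_posdef g_proper g_convex t1_gt0 Dx0
  xs1_min xbar_min (lexx _) l1.
have tri := ler_hess_normD f_sc f_posdef (x1 - xbar) (xbar - xs1) Dxs1.
rewrite addrA subrK in tri; apply: (le_trans tri).
have l0 := hess_norm_ge0 (f := f) xs1 (x0 - xs1).
have p0 := hess_norm_ge0 (f := f) xs1 (x1 - xbar).
have q0 := hess_norm_ge0 (f := f) xs1 (xbar - xs1).
have q1 : 0 <= 1 - hess_norm f xs1 (x0 - xs1) by rewrite subr_ge0 ltW.
have cmpq2 := le_trans
  (lerXn2r 2 (mulr_ge0 q0 q1) (hess_norm_ge0 _ _) cmpq) step.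
exact (corrector_bound l0 p0 q0 (ltW s_gt0) beta_le lam1 delta_le
  (le_trans cmpp dist) cmpq2).
Qed.
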